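(* Let $\tau>0$ and let $\pi$ be a probability measure on $\mathcal{B}=\bigcup_{n=1}^\infty(\{n\}\times B_n)$. Let $B_n^{(1)}=\{b_n\in B_n : F_{b_n}\in I_n^{(1)}\}$. Assume that $p(n)>0$ for $n=1,2,\dots$, and that for infinitely many $n$ the conditional density $\pi_n(b_{0,n},b_{1,n},\dots,b_{n,n})$ of $\pi(\cdot\mid\{n\}\times B_n^{(1)})$ has support $B_n^{(1)}$. Let $F$ be a given increasing and continuous function on $[0,\tau]$. Then for every $\epsilon>0$, $$\pi\Big\{(n,b_n)\in\bigcup_{n=2}^\infty(\{n\}\times B_n^{(1)}) : \|F_{b_n}-F\|_\infty<\epsilon\Big\}>0.$$
   Context: For integers $0\le i\le n$, $\varphi_{i,n}(t)=\binom{n}{i}t^i(1-t)^{n-i}$. Let $B_n=\mathbb{R}^{n+1}$, and for $b_n=(b_{0,n},\dots,b_{n,n})\in B_n$ let $F_{b_n}(t)=\sum_{i=0}^n b_{i,n}\varphi_{i,n}(t/\tau)$, $t\in[0,\tau]$. Let $I_n^{(1)}=\{F_a : a=(a_0,\dots,a_n)\in B_n,\ a_0\le a_1\le\cdots\le a_n\}$. The set $\mathcal{B}$ carries its Borel $\sigma$-field (disjoint union of the Euclidean spaces $B_n$). For the measure $\pi$, $p(n)=\pi(\{n\}\times B_n)$ is the probability of order $n$, with $\sum_{n=1}^\infty p(n)=1$; $\pi(\cdot\mid\{n\}\times B_n^{(1)})$ is the conditional probability given $\{n\}\times B_n^{(1)}$ (when the support hypothesis is imposed for a given $n$, it is understood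 that this conditioning event has positive $\pi$-probability), regarded as a distribution on $B_n^{(1)}\subset\mathbb{R}^{n+1}$ with density $\pi_n$. That it has support $B_n^{(1)}$ means that every nonempty relatively open subset of $B_n^{(1)}$ has positive conditional probability. $\|\cdot\|_\infty$ is the sup-norm on $[0,\tau]$. ''Increasing'' is meant in the weak sense (non-decreasing). *)

(* Defs.v *)
From HB Require Import structures.
From mathcomp Require Import all_boot all_order all_algebra.
From mathcomp Require Import all_classical all_reals all_analysis.

Set Implicit Arguments.
Unset Strict Implicit.
Unset Printing Implicit Defensive.

Import Order.TTheory GRing.Theory Num.Theory.
Import numFieldNormedType.Exports.

Local Open Scope classical_set_scope.
Local Open Scope ring_scope.

Definition posnat : Type := {n : nat | (0 < n)%N}.

Section BernsteinPolynomials.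
Variable R : realType.
Implicit Types (tau t : R) (n : nat).

Definition bernstein n (i : nat) t : R :=
  'C(n, i)%:R * t ^+ i * (1 - t) ^+ (n - i).

Definition bernstein_poly tau n (b : 'rV[R]_n.+1) t : R :=
  \sum_(i < n.+1) b 0 i * bernstein n i (t / tau).

(* A function on [0, tau] is represented by any function R -> R that extends
   it, so membership in this set only depends on the values on [0, tau]. *)
Definition I1 tau n : set (R -> R) :=
  [set f : R -> R | exists2 a : 'rV[R]_n.+1,
     (forall i j : 'I_n.+1, (i <= j)%N -> a 0 i <= a 0 j) &
     {in `[0, tau], f =1 bernstein_poly tau a}].

Definition B1 tau n : set 'rV[R]_n.+1 :=
  [set b | I1 tau n (bernstein_poly tau b)].

(* Taken in the extended reals, so that it is +oo on unbounded functions. *)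
Definition sup_norm tau (f : R -> R) : \bar R :=
  ereal_sup [set `|f t|%:E | t in [set` `[0, tau]]].

End BernsteinPolynomials.

Arguments I1 {R} tau n.
Arguments B1 {R} tau n.

Section Lebesgue.
Variables (R : realType) (n : nat).

Definition borel_rV : measurableType _ := g_sigma_algebraType (@open 'rV[R]_n).

(* This determines lambda: the boxes form a pi-system that generates the Borel
   sets and contains an exhausting sequence of sets of finite measure. *)
Definition is_lebesgue_measure
    (lambda : {measure set borel_rV -> \bar R}) : Prop :=
  forall a b : 'rV[R]_n, (forall i, a 0 i <= b 0 i) ->
    lambda [set x : 'rV[R]_n | forall i, a 0 i <= x 0 i <= b 0 i]
      = (\prod_(i < n) (b 0 i - a 0 i))%:E.

Definition is_density (f : borel_rV -> R) (P : set borel_rV -> \bar R) : Prop :=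
  [/\ measurable_fun setT f, forall b, 0 <= f b &
   exists2 lambda : {measure set borel_rV -> \bar R},
     is_lebesgue_measure lambda &
     forall A, measurable A -> P A = (\int[lambda]_(b in A) (f b)%:E)%E].

End Lebesgue.

Section CoefficientSpace.
Variable R : realType.

(* The union over n >= 1 of {n} x R^(n+1), with the disjoint union topology
   that the library puts on sigma types. *)
Definition coef_space : Type := {n : posnat & 'rV[R]_(sval n).+1}.

HB.instance Definition _ := Topological.on coef_space.
HB.instance Definition _ := isPointed.Build coef_space
  (existT (fun n : posnat => 'rV[R]_(sval n).+1) (exist _ 1%N isT) 0).

Definition borel_coef_space : measurableType _ :=
  g_sigma_algebraType (@open coef_space).

(* {n} x A *)
Definition fiber (n : posnat) (A : set 'rV[R]_(sval n).+1) :
    set borel_coef_space :=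
  existT (fun n : posnat => 'rV[R]_(sval n).+1) n @` A.

Arguments fiber n A : clear implicits.

(* The conditional probability given {n} x B, as a distribution on R^(n+1). *)
Definition cond_distr (pi : probability borel_coef_space R) (n : posnat)
    (B A : set 'rV[R]_(sval n).+1) : \bar R :=
  (pi (fiber n A `&` fiber n B) / pi (fiber n B))%E.

End CoefficientSpace.

Arguments fiber {R} n A.
Arguments cond_distr {R} pi n B A.

(* For P carried by B: every nonempty relatively open subset of B has positive
   P-mass. *)
Definition has_support (R : realType) (T : topologicalType)
    (P : set T -> \bar R) (B : set T) : Prop :=
  forall U : set T, open U -> U `&` B !=set0 -> (0 < P (U `&` B))%E.

(* Main.v *)
Require Import Defs.
From HB Require Import structures.
From mathcomp Require Import all_boot all_order all_algebra.
From mathcomp Require Import all_classical all_reals all_analysis.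
From mathcomp Require Import ring lra.
Import Order.TTheory GRing.Theory Num.Theory.
Import numFieldNormedType.Exports.
Local Open Scope classical_set_scope.
Local Open Scope ring_scope.

(* By linear independence of the Bernstein polynomials, B1 is the closed set of
   nondecreasing coefficient vectors, and b |-> F_b is 1-Lipschitz from the
   max norm to the sup norm, so the event of the theorem is the intersection of
   a closed and an open subset of the coefficient space; in particular it is
   measurable. Bernstein's theorem, applied with the nondecreasing coefficients
   F(tau * i / n), shows that for all large n the open set of those b with
   ||F_b - F|| < eps meets B1, and the support hypothesis for one such n gives
   positive mass. *)

(** * The Bernstein basis: moments, positivity, linear independence *)

(** Pascal's rule, transposed onto the coefficients [g]: a binomial mean over n + 1 trials is taken
    by conditioning on one trial. Moments then follow by induction on [n]. *)
Lemma bernsteinS_sum (R : realType) n (g : nat -> R) (x : R) :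
  \sum_(i < n.+2) g i * bernstein n.+1 i x =
  \sum_(i < n.+1) (x * g i.+1 + (1 - x) * g i) * bernstein n i x.
Proof.
(* The second sum may run up to n + 1 since ['C(n, n.+1)] = 0; both sides then share the term i = 0,
   and Pascal's rule matches the others. *)
have -> : \sum_(i < n.+1) (x * g i.+1 + (1 - x) * g i) * bernstein n i x =
    \sum_(i < n.+1) x * g i.+1 * bernstein n i x +
    \sum_(i < n.+2) g i * ('C(n, i)%:R * x ^+ i * (1 - x) ^+ (n.+1 - i)).
  rewrite [X in _ = _ + X]big_ord_recr /= bin_small // !mul0r mulr0 addr0.
  rewrite -big_split /=; apply: eq_bigr => i _; rewrite mulrDl /bernstein.
  by rewrite (subSn (leq_ord i)) [_ ^+ (_ - _).+1]exprS; ring.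
rewrite [LHS]big_ord_recl [X in _ = _ + X]big_ord_recl /= addrCA /bernstein !bin0.
congr (_ + _); rewrite -big_split /=; apply: eq_bigr => i _.
by rewrite /bump !add1n subSS binS natrD exprS; ring.
Qed.

Lemma bernstein_sum1 (R : realType) n (x : R) :
  \sum_(i < n.+1) bernstein n i x = 1.
Proof.
elim: n => [|n IHn]; first by rewrite big_ord1 /bernstein !expr0 !mulr1.
have := bernsteinS_sum R n (fun=> 1) x.
under eq_bigr do rewrite mul1r.
by under [in RHS]eq_bigr do rewrite !mulr1 addrC subrK mul1r; rewrite IHn.
Qed.

(** For x in [0, 1] this is the variance of a binomial variable; each further trial adds x(1 -
    x). *)
Lemma bernstein_variance (R : realType) n (x : R) :
  \sum_(i < n.+1) (i%:R - n%:R * x) ^+ 2 * bernstein n i x =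
  n%:R * (x * (1 - x)).
Proof.
elim: n => [|n IHn]; first by rewrite big_ord1 !mul0r subrr expr2 !mul0r.
rewrite (bernsteinS_sum R n (fun i => (i%:R - n.+1%:R * x) ^+ 2)).
(* With u = i - nx, x(u + 1 - x)^2 + (1 - x)(u - x)^2 = u^2 + x(1 - x). *)
transitivity (\sum_(i < n.+1) (i%:R - n%:R * x) ^+ 2 * bernstein n i x +
    \sum_(i < n.+1) x * (1 - x) * bernstein n i x).
  by rewrite -big_split /=; apply: eq_bigr => i _; rewrite -!natr1; ring.
by rewrite IHn -mulr_sumr bernstein_sum1 -natr1; ring.
Qed.

Lemma bernstein_ge0 (R : realType) n i (x : R) :
  0 <= x <= 1 -> 0 <= bernstein n i x.
Proof.
by move=> /andP[x0 x1]; rewrite !mulr_ge0 ?exprn_ge0 ?subr_ge0.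
Qed.

(* Under t = x / (1 + x), a linear relation between the Bernstein polynomials
   of degree n becomes, up to the factor (1 + x) ^+ n, a polynomial in x. *)
Lemma bernstein_poly_inj (R : realType) (tau : R) n (a b : 'rV[R]_n.+1) :
  0 < tau -> {in `[0, tau], bernstein_poly tau a =1 bernstein_poly tau b} ->
  a = b.
Proof.
move=> tau0 ab.
pose p := \poly_(i < n.+1) ((a 0 (inord i) - b 0 (inord i)) * 'C(n, i)%:R).
have rootp (k : nat) : p.[k%:R] = 0.
  have k1 : 1 + k%:R != 0 :> R by rewrite addrC natr1 pnatr_eq0.
  have k1_gt0 : 0 < 1 + k%:R :> R by rewrite addrC natr1 ltr0n.
  pose t : R := k%:R / (1 + k%:R).
  have ttau : t * tau \in `[0, tau].
    have [tau_ge0 k1_ge0] := (ltW tau0, ltW k1_gt0).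
    rewrite in_itv /= mulr_ge0 ?divr_ge0 //=.
    by rewrite ler_piMl // ler_pdivrMr // mul1r lerDr.
  have := ab _ ttau => /eqP; rewrite -subr_eq0 => /eqP.
  rewrite /bernstein_poly mulfK ?gt_eqF // -sumrB => sum0.
  rewrite horner_poly.
  transitivity ((1 + k%:R) ^+ n *
      \sum_(i < n.+1) (a 0 i * bernstein n i t - b 0 i * bernstein n i t)).
    rewrite mulr_sumr; apply: eq_bigr => i _; rewrite inord_val /bernstein.
    have -> : 1 - t = (1 + k%:R)^-1 by rewrite /t; field.
    have -> : (1 + k%:R : R) ^+ n = (1 + k%:R) ^+ (n - i) * (1 + k%:R) ^+ i.
      by rewrite -exprD subnK // leq_ord.
    by rewrite /t expr_div_n exprVn; field; rewrite !expf_neq0.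
  by rewrite sum0 mulr0.
(* The roots 0, ..., n are n + 1 in number, while [p] has degree at most n. *)
have p0 : p = 0.
  apply: (@roots_geq_poly_eq0 _ p [seq k%:R | k <- iota 0 n.+1]).
  - by apply/allP => _ /mapP[k _ ->]; rewrite rootE rootp.
  - by rewrite map_inj_uniq ?iota_uniq // => i j /eqP; rewrite eqr_nat => /eqP.
  - by rewrite size_map size_iota size_poly.
apply/rowP => i; apply/eqP; rewrite -subr_eq0.
have := coef_poly n.+1
  (fun i => (a 0 (inord i) - b 0 (inord i)) * 'C(n, i)%:R) i.
rewrite -/p p0 coef0 ltn_ord inord_val => /esym/eqP.
by rewrite mulf_eq0 pnatr_eq0 -leqn0 leqNgt bin_gt0 -ltnS ltn_ord orbF.
Qed.

(** * The closed cone of monotone coefficients and open sup-norm balls *)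

(** [I1] only provides some monotone [a] with the same polynomial on [0, tau]; injectivity forces
    [a = b]. *)
Lemma B1E (R : realType) (tau : R) n : 0 < tau ->
  B1 tau n = [set b | forall i j : 'I_n.+1, (i <= j)%N -> b 0 i <= b 0 j].
Proof.
move=> tau0; apply/seteqP; split => b /=.
  by move=> [a am /(bernstein_poly_inj _ _ _ _ _ tau0) ->].
by move=> bm; exists b.
Qed.

Lemma closed_B1 (R : realType) (tau : R) n : 0 < tau -> closed (B1 tau n).
Proof.
move=> tau0.
have -> : B1 tau n = \bigcap_(ij in [set ij : 'I_n.+1 * 'I_n.+1 |
      (ij.1 <= ij.2)%N])
      ((fun b : 'rV[R]_n.+1 => b 0 ij.2 - b 0 ij.1) @^-1` [set x | 0 <= x]).
  rewrite B1E //.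
  apply/seteqP; split=> [b bm [i j] /= ij|b bm i j ij].
    by rewrite subr_ge0; exact: bm.
  by rewrite -subr_ge0; exact: (bm (i, j)).
apply: closed_bigI => -[i j] _; apply: closed_comp; last exact: closed_ge.
by move=> b _; apply: continuousB; exact: coord_continuous.
Qed.

(** On [0, tau] the Bernstein weights are nonnegative with sum 1, so the difference is a weighted
    mean of the coefficient differences. *)
Lemma bernstein_poly_dist (R : realType) (tau : R) n (a b : 'rV[R]_n.+1) d t :
  0 < tau -> t \in `[0, tau] -> (forall i, `|a 0 i - b 0 i| <= d) ->
  `|bernstein_poly tau a t - bernstein_poly tau b t| <= d.
Proof.
move=> tau0; rewrite in_itv /= => /andP[t0 t1] abd.
have x01 : 0 <= t / tau <= 1.
  by rewrite divr_ge0 ?(ltW tau0) //= ler_pdivrMr // mul1r.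
rewrite /bernstein_poly -sumrB.
under eq_bigr do rewrite -mulrBl.
rewrite (le_trans (ler_norm_sum _ _ _)) //.
rewrite -[leRHS]mulr1 -(bernstein_sum1 R n (t / tau)) mulr_sumr ler_sum // => i _.
have b0 := bernstein_ge0 R n i _ x01.
by rewrite normrM (ger0_norm b0) ler_wpM2r.
Qed.

Lemma sup_norm_le (R : realType) (tau d : R) (f : R -> R) :
  {in `[0, tau], forall t, `|f t| <= d} -> (sup_norm tau f <= d%:E)%E.
Proof. by move=> fd; apply: ge_ereal_sup => _ [t /fd td <-]; rewrite lee_fin. Qed.

Lemma open_sup_norm_lt (R : realType) (tau eps : R) n (F : R -> R) : 0 < tau ->
  open [set b : 'rV[R]_n.+1 |
    (sup_norm tau (bernstein_poly tau b \- F)%R < eps%:E)%E].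
Proof.
move=> tau0; rewrite openE => b /= b_eps; apply/nbhs_ballP.
have ub t : t \in `[0, tau] -> (`|(bernstein_poly tau b \- F) t|%:E <=
    sup_norm tau (bernstein_poly tau b \- F)%R)%E.
  by move=> tt; apply: ereal_sup_ubound; exists t.
(* The value at 0 rules out a supremum of -oo, and [b_eps] rules out +oo. *)
have := ub 0; rewrite in_itv /= lexx ltW // => /(_ erefl).
move: b_eps ub; case: (sup_norm _ _) => [r| |] //.
rewrite lte_fin => r_eps ub _.
(* Half the gap keeps the bound at (r + eps) / 2, still below [eps] after passing to the
   supremum. *)
exists ((eps - r) / 2) => /=; first by rewrite divr_gt0 // subr_gt0.
move=> a ba; apply: (@le_lt_trans _ _ ((r + eps) / 2)%:E); last first.
  by rewrite lte_fin; lra.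
apply: sup_norm_le => t tt; have := ub _ tt; rewrite lee_fin /= => brt.
have : `|bernstein_poly tau a t - bernstein_poly tau b t| <= (eps - r) / 2.
  apply: bernstein_poly_dist => // i; rewrite distrC; apply: ltW.
  exact: ba.2.
move: brt; rewrite !ler_norml => /andP[? ?] /andP[? ?]; apply/andP; split; lra.
Qed.

(** * Bernstein's approximation theorem for monotone continuous functions *)

Lemma segment_unif_continuous (R : realType) (a b : R) (F : R -> R) (e : R) :
  {within `[a, b], continuous F} -> 0 < e ->
  exists2 d : R, 0 < d & {in `[a, b] &, forall s t, `|s - t| < d ->
    `|F s - F t| < e}.
Proof.
move=> F_cont e0.
suff H : \forall d \near 0^'+, `[a, b] `<=` [set s |
    {in `[a, b], forall t, `|s - t| < d -> `|F s - F t| < e}].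
  have [d [dF d0]] := filter_ex (filterI H (@nbhs_right_gt R 0)).
  by exists d => // s t sab tab; exact: dF.
(* Compactness turns a threshold for [d] valid near each point into one valid on the whole
   segment. *)
have /compact_near_coveringP/near_covering_withinP := @segment_compact R a b.
apply => x abx.
have : \forall y \near within `[a, b] (nbhs x), `|F x - F y| < e / 2.
  have /cvgrPdist_lt := (iffLR (subspace_continuousP _ _) F_cont) x abx.
  by apply; rewrite divr_gt0.
rewrite near_withinE => /nbhs_ballP[r /= r0 xr].
(* Two distances below r / 2 keep [t], as well as [s], within [r] of [x]. *)
exists (ball x (r / 2), [set d | d < r / 2]) => /=.
  split; first by apply: nbhsx_ballx; rewrite divr_gt0.
  by apply: nbhs_right_lt; rewrite divr_gt0.
move=> [s d] /= [xs dr] sab t tab st; rewrite /ball /= in xs xr.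
have xs_r : `|x - s| < r by lra.
have xt_r : `|x - t| < r.
  by rewrite -(subrKA s) (le_lt_trans (ler_normD _ _)) //; lra.
have /= := xr _ xs_r sab; have /= := xr _ xt_r tab => xFt xFs.
rewrite -(subrKA (F x)) (le_lt_trans (ler_normD _ _)) // distrC; lra.
Qed.

(** Chebyshev's argument: nodes near [t] are handled by uniform continuity, distant ones by the
    variance, the oscillation being at most [F tau - F 0] by monotonicity. *)
Lemma bernstein_approx (R : realType) (tau e : R) (F : R -> R) :
  0 < tau -> {in `[0, tau] &, {homo F : s t / s <= t}} ->
  {within `[0, tau], continuous F} -> 0 < e ->
  exists N : nat, forall n, (N <= n)%N -> (0 < n)%N ->
    {in `[0, tau], forall t,
      `|bernstein_poly tau (\row_(i < n.+1) F (tau * (i%:R / n%:R))) t - F t|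
        <= e}.
Proof.
move=> tau0 F_nd F_cont e0.
have [d d0 Fd] := segment_unif_continuous _ _ _ _ _ F_cont (divr_gt0 e0 (ltr0Sn R 1)).
pose K := (F tau - F 0) * (tau / d) ^+ 2.
have tau_in : tau \in `[0, tau] by rewrite in_itv /= lexx ltW.
have zero_in : 0 \in `[0, tau] by rewrite in_itv /= lexx ltW.
have D0 : 0 <= F tau - F 0 by rewrite subr_ge0 F_nd // ltW.
have K0 : 0 <= K by rewrite mulr_ge0 // sqr_ge0.
(* This makes K / n at most e / 2, where K x(1 - x) / n is the mean of the quadratic term in
   [osc]. *)
exists (Num.bound (K / (e / 2))) => n Nn n0 t tt.
have nR : 0 < n%:R :> R by rewrite ltr0n.
set x := t / tau.
have x01 : 0 <= x <= 1.
  move: tt; rewrite in_itv /= => /andP[t0 t1].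
  by rewrite divr_ge0 ?(ltW tau0) //= ler_pdivrMr // mul1r.
have osc s : s \in `[0, tau] ->
    `|F s - F t| <= e / 2 + (F tau - F 0) * ((s - t) / d) ^+ 2.
  move=> ss; have [st|st] := ltP `|s - t| d.
    rewrite (le_trans (ltW (Fd _ _ ss tt st))) // lerDl mulr_ge0 ?sqr_ge0 //.
  have Fst : `|F s - F t| <= F tau - F 0.
    have := (ss, tt); rewrite !in_itv /= => -[/andP[s0 s1] /andP[t0 t1]].
    have := F_nd _ _ ss tau_in s1; have := F_nd _ _ zero_in ss s0.
    have := F_nd _ _ tt tau_in t1; have := F_nd _ _ zero_in tt t0.
    by rewrite ler_norml; move=> *; apply/andP; split; lra.
  have sd : 1 <= ((s - t) / d) ^+ 2.
    rewrite -real_normK ?num_real // normrM normfV (gtr0_norm d0).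
    by rewrite exprn_ege1 // ler_pdivlMr // mul1r.
  rewrite (le_trans Fst) // -[leLHS]add0r lerD //; first by rewrite divr_ge0 // ltW.
  by rewrite ler_peMr.
have Ft : F t = \sum_(i < n.+1) F t * bernstein n i x.
  by rewrite -mulr_sumr bernstein_sum1 mulr1.
rewrite /bernstein_poly -/x Ft -sumrB.
rewrite (le_trans (ler_norm_sum _ _ _)) //.
have -> : e = e / 2 + e / 2 by lra.
apply: (@le_trans _ _ (\sum_(i < n.+1)
   (e / 2 + (F tau - F 0) * ((tau * (i%:R / n%:R) - t) / d) ^+ 2)
     * bernstein n i x)).
  apply: ler_sum => i _; have b0 := bernstein_ge0 R n i _ x01.
  rewrite mxE -mulrBl normrM (ger0_norm b0) ler_wpM2r //; apply: osc.
  rewrite in_itv /= mulr_ge0 ?divr_ge0 ?(ltW tau0) //=.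
  by rewrite ler_piMr ?(ltW tau0) // ler_pdivrMr // mul1r ler_nat leq_ord.
under eq_bigr do rewrite mulrDl.
rewrite big_split /= -mulr_sumr bernstein_sum1 mulr1 lerD2l.
(* Since t = tau x, the node i lies at signed distance (tau / n)(i - nx) from t. *)
rewrite (_ : \sum_(i < n.+1) _ = K / n%:R ^+ 2 *
    \sum_(i < n.+1) (i%:R - n%:R * x) ^+ 2 * bernstein n i x); last first.
  rewrite mulr_sumr; apply: eq_bigr => i _; rewrite /K /x.
  by field; rewrite !gt_eqF.
rewrite bernstein_variance.
have -> : K / n%:R ^+ 2 * (n%:R * (x * (1 - x))) = K / n%:R * (x * (1 - x)).
  by field; rewrite gt_eqF.
apply: (@le_trans _ _ (K / n%:R)).
  move: x01 => /andP[x0 x1]; rewrite ler_piMr ?divr_ge0 ?(ltW nR) //.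
  nra.
have e2 : 0 < e / 2 by rewrite divr_gt0.
rewrite ler_pdivrMr // mulrC -ler_pdivrMr // ltW //.
rewrite (lt_le_trans (archi_boundP _)) ?ler_nat //.
by rewrite divr_ge0 // ltW.
Qed.

(** * Measurability and positive mass of the event *)

Lemma sval_lt_finite (N : nat) : finite_set [set n : posnat | (sval n < N)%N].
Proof.
apply: (@finite_preimage _ _ `I_N (@sval nat (fun n => (0 < n)%N))) => //.
by move=> m n _ _; exact: val_inj.
Qed.

Theorem proposition3 (R : realType) (tau : R) (tau_gt0 : 0 < tau)
  (pi : probability (borel_coef_space R) R)
  (p_gt0 : forall n : posnat, (0 < pi (fiber n [set: 'rV[R]_(sval n).+1]))%E)
  (supp : infinite_set [set n : posnat |
     (0 < pi (fiber n (B1 tau (sval n))))%E /\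
     (exists2 pi_n : 'rV[R]_(sval n).+1 -> R,
        is_density pi_n (cond_distr pi n (B1 tau (sval n))) &
        has_support (cond_distr pi n (B1 tau (sval n)))
          (B1 tau (sval n)))])
  (F : R -> R)
  (F_nondecr : {in `[0, tau] &, {homo F : s t / s <= t}})
  (F_cont : {within `[0, tau], continuous F})
  (eps : R) (eps_gt0 : 0 < eps) :
  (0 < pi [set x : borel_coef_space R |
     (\bigcup_(n in [set n : posnat | (2 <= sval n)%N])
        fiber n (B1 tau (sval n))) x
     /\ sup_norm tau (bernstein_poly tau (projT2 x) \- F)%R < eps%:E])%E.
Proof.
(* Halving [eps] leaves room for the strict inequality, as the approximation and the supremum give
   weak bounds. *)
have eps2 : 0 < eps / 2 by rewrite divr_gt0.
have [N approx] := bernstein_approx R tau (eps / 2) F tau_gt0 F_nondecr F_cont eps2.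
have [n [[_ [_ _ n_supp]] nN]] : exists n : posnat,
    ((0 < pi (fiber n (B1 tau (sval n))))%E /\
     (exists2 pi_n : 'rV[R]_(sval n).+1 -> R,
        is_density pi_n (cond_distr pi n (B1 tau (sval n))) &
        has_support (cond_distr pi n (B1 tau (sval n)))
          (B1 tau (sval n)))) /\ (maxn 2 N <= sval n)%N.
  apply: contrapT => small; apply: supp.
  apply: (sub_finite_set _ (sval_lt_finite (maxn 2 N))) => n /= n_supp.
  by rewrite ltnNge; apply/negP => nN; apply: small; exists n.
move: nN; rewrite geq_max => /andP[n2 nN].
pose C : set (coef_space R) := [set x | (2 <= sval (projT1 x))%N /\
  B1 tau (sval (projT1 x)) (projT2 x)].
pose O : set (coef_space R) := [set x |
  (sup_norm tau (bernstein_poly tau (projT2 x) \- F)%R < eps%:E)%E].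
pose U := [set b : 'rV[R]_(sval n).+1 |
  (sup_norm tau (bernstein_poly tau b \- F)%R < eps%:E)%E].
have openU : open U by exact: open_sup_norm_lt.
have openO : open O by apply/sigT_openP => m; exact: open_sup_norm_lt.
have closedC : closed C.
  (* Openness is tested fibre by fibre; over order 1 the complement of [C] is the whole fibre. *)
  rewrite -openC; apply/sigT_openP => m.
  have [m2|m2] := leqP 2 (sval m).
    rewrite (_ : _ @^-1` _ = ~` B1 tau (sval m)).
      by rewrite openC; exact: closed_B1.
    by apply/seteqP; split=> b /= Cb; [move=> Bb; exact: Cb|case].
  rewrite (_ : _ @^-1` _ = setT); first exact: openT.
  by apply/seteqP; split=> // b _ /= []; rewrite /= leqNgt m2.
have mO (A : set (coef_space R)) : open A ->
    measurable (A : set (borel_coef_space R)).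
  by move=> oA; exact: sub_sigma_algebra.
have mC : measurable (C : set (borel_coef_space R)).
  by rewrite -[C]setCK; apply: measurableC; apply: mO; rewrite openC.
have -> : [set x : borel_coef_space R |
     (\bigcup_(n in [set n : posnat | (2 <= sval n)%N])
        fiber n (B1 tau (sval n))) x
     /\ (sup_norm tau (bernstein_poly tau (projT2 x) \- F)%R < eps%:E)%E] = C `&` O.
  apply/seteqP; split=> [x [[m /= m2 [b Bb <-]] xO]|[m b] [[/= m2 Bb] xO]] //.
  by split=> //; exists m => //; exists b.
(* The part of the event in the single fibre [n], where the support hypothesis applies. *)
pose V := fiber n (U `&` B1 tau (sval n)).
have VE : V = (fiber n U : set (borel_coef_space R)) `&` C.
  apply/seteqP; split=> [_ [b [Ub Bb] <-]|_ [[b Ub <-] [_ Bb]]].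
    by split; [exists b|].
  by exists b.
apply: (@lt_le_trans _ _ (pi V)); last first.
  apply: le_measure; rewrite ?inE.
  - by rewrite VE; apply: measurableI => //; apply: mO; exact: existT_open_map.
  - by apply: measurableI => //; exact: mO.
  - by rewrite VE => _ [[b Ub <-] Cb].
have := n_supp U openU; rewrite /cond_distr -/V.
have -> : V `&` fiber n (B1 tau (sval n)) = V.
  by apply/setIidPl => _ [b [_ Bb] <-]; exists b.
(* If [V] were null, its conditional probability would vanish too, contradicting the support
   hypothesis once [U] meets [B1]. *)
move=> cond; rewrite lt_neqAle measure_ge0 andbT; apply/eqP => V0.
suff /cond : U `&` B1 tau (sval n) !=set0 by rewrite -V0 mul0e ltxx.
(* Sampling [F] at equally spaced nodes gives Bernstein's approximant, with coefficients as monotone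
   as [F]. *)
exists (\row_(i < (sval n).+1) F (tau * (i%:R / (sval n)%:R))); split.
  apply: (@le_lt_trans _ _ (eps / 2)%:E).
    by apply: sup_norm_le; apply: approx => //; exact: ltnW.
  by rewrite lte_fin ltr_pdivrMr // ltr_pMr // ltr1n.
rewrite B1E // => i j ij; rewrite !mxE.
have node k : (k <= sval n)%N -> tau * (k%:R / (sval n)%:R) \in `[0, tau].
  move=> kn; rewrite in_itv /= mulr_ge0 ?divr_ge0 ?(ltW tau_gt0) //=.
  rewrite ler_piMr ?(ltW tau_gt0) // ler_pdivrMr ?mul1r ?ler_nat //.
  by rewrite ltr0n ltnW.
apply: F_nondecr; rewrite ?node ?leq_ord //.
by rewrite ler_pM2l // ler_wpM2r ?invr_ge0 // ler_nat.
Qed.
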